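(* Let $X$ be a cadlag real valued stochastic process which is left-continuous in probability. Then, with probability $1$, $$\left\{(t,X_{t-}):t\in\mathbb{R}_+\right\}\subseteq\mathrm{MSupp}(X).$$
   Context: The process $X$ is indexed by $\mathbb{R}_+=[0,\infty)$. $X_{t-}$ denotes the left limit of $X$ at $t$, with $X_{0-}=X_0$. Support: for a real valued random variable $V$, $\mathrm{Supp}(V)$ is the smallest closed subset of $\mathbb{R}$ with $\mathbb{P}(V\in\mathrm{Supp}(V))=1$. Marginal support: $\mathrm{MSupp}(X)=\{(t,x)\in\mathbb{R}_+\times\mathbb{R}: x\in\mathrm{Supp}(X_t)\}$. *)

(* Defs.v *)
From HB Require Import structures.
From mathcomp Require Import all_boot all_order all_algebra.
From mathcomp Require Import all_classical all_reals all_analysis.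
From mathcomp Require Import measurable_realfun.

Set Implicit Arguments.
Unset Strict Implicit.
Unset Printing Implicit Defensive.

Import Order.TTheory GRing.Theory Num.Theory.
Import numFieldNormedType.Exports.

Local Open Scope classical_set_scope.
Local Open Scope ring_scope.

(* Paths and processes are indexed by all of R so that the filters t^'+ and
   t^'- can be used directly.  Only times t >= 0 are ever constrained or used:
   t^'- only appears at t > 0, where it contains ]0, t[. *)

Definition cadlag (R : realType) (x : R -> R) : Prop :=
  (forall t, 0 <= t -> x s @[s --> t^'+] --> x t) /\
  (forall t, 0 < t -> cvg (x s @[s --> t^'-])).

Definition left_limit (R : realType) (x : R -> R) (t : R) : R :=
  if t == 0 then x 0 else lim (x s @[s --> t^'-]).

Section process.
Context {R : realType} {d : measure_display} {T : measurableType d}.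
Context {P : probability T R}.
Implicit Types (V Y : {RV P >-> R}) (X : R -> {RV P >-> R}).

Definition cadlag_process X : Prop := forall w, cadlag (fun t => X t w).

Definition cvg_in_probability (I : Type) (F : set_system I)
    (Z : I -> {RV P >-> R}) Y : Prop :=
  forall e : R, 0 < e ->
    P [set w | e < `|Z i w - Y w|] @[i --> F] --> 0%E.

Definition left_continuous_in_probability X : Prop :=
  forall t, 0 < t -> cvg_in_probability t^'- X (X t).

(* The intersection of all closed sets of full probability; by [Supp_closed],
   [Supp_full] and [Supp_min] it is the least such set. *)
Definition Supp V : set R :=
  smallest (fun C : set R => closed C /\ P (V @^-1` C) = 1%E) set0.

Definition MSupp X : set (R * R) :=
  [set tx | 0 <= tx.1 /\ Supp (X tx.1) tx.2].

Lemma Supp_closed V : closed (Supp V).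
Proof. by apply: closed_bigI => C [[]]. Qed.

Lemma Supp_min V (C : set R) :
  closed C -> P (V @^-1` C) = 1%E -> Supp V `<=` C.
Proof. by move=> cC PC x; apply; split. Qed.

Lemma Supp_full V : P (V @^-1` Supp V) = 1%E.
Proof.
have mV (A : set R) : measurable A -> measurable (V @^-1` A).
  by move=> mA; rewrite -[_ @^-1` _]setTI; exact: measurable_funP.
have mSupp : measurable (Supp V) by apply: closed_measurable; exact: Supp_closed.
pose J (q : rat * rat) : set R := `]ratr q.1, ratr q.2[%classic.
pose N (k : nat) : set T :=
  if unpickle k is Some q then
    if `[< P (V @^-1` J q) = 0%E >] then V @^-1` J q else set0
  else set0.
have N0 k : P.-negligible (N k).
  rewrite /N; case: unpickle => [q|]; last exact: negligible_set0.
  case: asboolP => [Pq|_]; last exact: negligible_set0.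
  by exists (V @^-1` J q); split => //; apply: mV; exact: measurable_itv.
have NE q : P (V @^-1` J q) = 0%E -> N (pickle q) = V @^-1` J q.
  by move=> Pq; rewrite /N pickleK asboolT.
have sub : V @^-1` (~` Supp V) `<=` \bigcup_k N k.
  move=> w /= /existsNP[C /not_implyP[[[cC PC] _] nCw]].
  have oC : open (~` C) by exact: closed_openC.
  have /nbhs_ballP[e /= e0 eC] : nbhs (V w) (~` C) by exact: open_nbhs_nbhs.
  have [a /andP[a1 a2]] : exists a : rat, (V w - e < ratr a < V w)%R.
    have [|a] := @rat_in_itvoo R (V w - e) (V w); first by rewrite ltrBlDr ltrDl.
    by rewrite in_itv /=; exists a.
  have [b /andP[b1 b2]] : exists b : rat, (V w < ratr b < V w + e)%R.
    have [|b] := @rat_in_itvoo R (V w) (V w + e); first by rewrite ltrDl.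
    by rewrite in_itv /=; exists b.
  have Pab : P (V @^-1` J (a, b)) = 0%E.
    apply/eqP; rewrite eq_le measure_ge0 andbT.
    have <- : P (V @^-1` (~` C)) = 0%E.
      rewrite preimage_setC probability_setC ?PC ?subee//.
      by apply: mV; exact: closed_measurable.
    apply: le_measure; rewrite ?inE.
    - by apply: mV; exact: measurable_itv.
    - by apply: mV; exact: open_measurable.
    - move=> v; rewrite /J /= in_itv /= => /andP[v1 v2]; apply: eC.
      rewrite /ball /= ltr_norml; apply/andP; split.
      + by rewrite ltrBrDl ltrBlDr; exact: lt_trans v2 b2.
      + by rewrite ltrBlDr addrC -ltrBlDr; exact: lt_trans a1 v1.
  have : V w \in J (a, b) by rewrite inE /J /= in_itv /= a2 b1.
  rewrite inE => Jw; exists (pickle (a, b)); first exact: I.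
  by rewrite NE.
have P0 : P (V @^-1` (~` Supp V)) = 0%E.
  apply/measure_negligible; first by apply: mV; exact: measurableC.
  by apply: negligibleS sub _; exact: negligible_bigcup.
have mU : measurable (V @^-1` (~` Supp V)) by apply: mV; exact: measurableC.
have -> : V @^-1` Supp V = ~` (V @^-1` (~` Supp V)) by rewrite preimage_setC setCK.
by rewrite probability_setC// P0 sube0.
Qed.

End process.

(* Main.v *)
Require Import Defs.
From mathcomp Require Import all_boot all_order all_algebra.
From mathcomp Require Import all_classical all_reals all_analysis.
From mathcomp Require Import measurable_realfun.
Import Order.TTheory GRing.Theory Num.Theory.
Import numFieldNormedType.Exports.
Local Open Scope classical_set_scope.
Local Open Scope ring_scope.

(** At one fixed time t the claim is easy: left-continuity in probability forces
    X_{t-} = X_t almost surely, and X_t lies in its support almost surely.  The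
    difficulty is to find one null set that serves uncountably many times.

    A value lies outside Supp(X_t) exactly when some open interval J with
    rational endpoints contains it and P(X_t \in J) = 0, so it suffices to treat
    each of the countably many J separately.  Let S be the set of times t >= 0
    with P(X_t \in J) = 0.  By [countable_left_dense], S has a countable subset D
    such that every point of S outside D is a limit of points of D from the
    left.  Off a null set, X_t = X_{t-} and X_t \notin J for all t in D; on such
    a path X_{t-} \notin J for every t in S.  For t in D this is immediate; for
    t in S outside D, if X_{t-} were in the open set J, then X_s would be in J
    for all s < t close to t, among them some s in D. *)

(** Take one point of S in each rational interval that meets S; these points
    accumulate from the left at each left accumulation point of S.  Every other
    point of S is the least element of S above some rational, so there are only
    countably many of them and D can contain them all. *)
Lemma countable_left_dense (R : realType) (S : set R) :
  exists D : set R, [/\ countable D, D `<=` S &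
    forall t, S t -> ~ D t ->
      forall e, 0 < e -> exists2 s, D s & t - e < s < t].
Proof.
(* L p has at most one element, the least point of S above p. *)
pose L (p : rat) : set R :=
  [set t | [/\ S t, ratr p < t & forall s, S s -> ratr p < s -> t <= s]].
pose M (q : rat * rat) : set R := S `&` [set s | ratr q.1 < s < ratr q.2].
pose f (i : rat + rat * rat) : R :=
  match i with inl p => xget 0 (L p) | inr q => xget 0 (M q) end.
exists (S `&` range f); split.
- apply: sub_countable (subset_card_le (@subIsetr _ _ _)) _.
  exact: sub_countable (card_image_le _ _) (countableP _).
- exact: subIsetl.
- move=> t St nDt e e0.
  have [p] := @rat_in_itvoo R (t - e) t ltac:(by rewrite ltrBlDr ltrDl).
  rewrite in_itv /= => /andP[tep pt].
  have [s /= Ss /andP[ps st]] : exists2 s, S s & ratr p < s < t.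
    apply/not_exists2P => nS; apply: nDt; split=> //; exists (inl p) => //=.
    have Ltp : L p t.
      split=> // s Ss ps; rewrite leNgt; apply/negP => st.
      by case: (nS s) => //; rewrite ps st.
    apply: (xget_unique _ Ltp) => u [Su pu uS].
    have [_ _ tS] := Ltp; apply/eqP; by rewrite eq_le uS// tS.
  have [q] := @rat_in_itvoo R s t st.
  rewrite in_itv /= => /andP[sq qt].
  have [] : M (p, q) (xget 0 (M (p, q))).
    by apply: (@xgetPex _ 0); exists s; split=> //=; rewrite ps sq.
  set r := xget _ _ => Sr /= /andP[pr rq].
  exists r; first by split=> //; exists (inr (p, q)).
  by rewrite (lt_trans tep pr) (lt_trans rq qt).
Qed.

Lemma ae_forall_countable (R : realType) (d : measure_display)
    (T : measurableType d) (mu : {measure set T -> \bar R})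
    (I : Type) (D : set I) (Q : I -> T -> Prop) :
  countable D -> (forall i, D i -> {ae mu, forall w, Q i w}) ->
  {ae mu, forall w, forall i, D i -> Q i w}.
Proof.
move=> /countable_injP[f finj] DQ.
pose F n : set T := [set w | exists i, [/\ D i, f i = n & ~ Q i w]].
have F0 n : mu.-negligible (F n).
  have [[i [Di fi]]|nD] := pselect (exists i, D i /\ f i = n).
    apply: negligibleS (DQ i Di) => w [j [Dj fj nQ]].
    by rewrite (finj i j) ?inE// fi fj.
  apply: negligibleS (negligible_set0 _) => w [j [Dj fj _]].
  by case: nD; exists j.
apply: negligibleS (negligible_bigcup F0) => w /= /existsNP[i /not_implyP[Di nQ]].
by exists (f i) => //; exists i.
Qed.

Section process.
Context {R : realType} {d : measure_display} {T : measurableType d}.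
Context {P : probability T R}.
Implicit Types (V : {RV P >-> R}) (X : R -> {RV P >-> R}).

Let mpre V (A : set R) : measurable A -> measurable (V @^-1` A).
Proof. by move=> mA; rewrite -[_ @^-1` _]setTI; exact: measurable_funP. Qed.

Lemma negligible_preimage_rat_itv V x : ~ Supp V x ->
  exists q : rat * rat, ratr q.1 < x < ratr q.2 /\
    P.-negligible (V @^-1` `]ratr q.1, ratr q.2[).
Proof.
move=> /existsNP[C /not_implyP[[[cC PC] _] nCx]].
have oC : open (~` C) by exact: closed_openC.
have /nbhs_ballP[e /= e0 eC] : nbhs x (~` C) by exact: open_nbhs_nbhs.
have [a] := @rat_in_itvoo R (x - e) x ltac:(by rewrite ltrBlDr ltrDl).
rewrite in_itv /= => /andP[a1 a2].
have [b] := @rat_in_itvoo R x (x + e) ltac:(by rewrite ltrDl).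
rewrite in_itv /= => /andP[b1 b2].
exists (a, b); split; first by rewrite a2 b1.
exists (V @^-1` (~` C)); split.
  by apply: mpre; apply: measurableC; exact: closed_measurable.
  rewrite preimage_setC probability_setC ?PC ?subee//.
  by apply: mpre; exact: closed_measurable.
move=> w; rewrite /= in_itv /= => /andP[v1 v2]; apply: eC.
rewrite /ball /= ltr_norml; apply/andP; split.
- by rewrite ltrBrDl ltrBlDr; exact: lt_trans v2 b2.
- by rewrite ltrBlDr addrC -ltrBlDr; exact: lt_trans a1 v1.
Qed.

(** Each tail intersection of the A n has probability at most P (A n) for all
    large n, hence is null; the event is the countable union of these. *)
Lemma negligible_eventually (A : (set T)^nat) :
  (forall n, measurable (A n)) -> P (A n) @[n --> \oo] --> 0%E ->
  P.-negligible [set w | \forall n \near \oo, A n w].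
Proof.
move=> mA PA0.
pose B m := \bigcap_(n in [set n | (m <= n)%N]) A n.
have mB m : measurable (B m) by apply: bigcap_measurable => //; exists m => /=.
have PB m : P.-negligible (B m).
  apply/negligibleP => //; apply/eqP; rewrite eq_le measure_ge0 andbT.
  apply: (@cvge_to_ge _ _ _ _ _ _ _ PA0).
  exists m => // n /= mn; apply: le_measure; rewrite ?inE//.
  by move=> w; apply.
apply: negligibleS (negligible_bigcup PB) => w [m _ mA'].
by exists m => // n /= mn; exact: mA'.
Qed.

(** Where Y' and Y differ, |Z n - Y| > 1/(k+1) eventually in n, for some k; these
    events are measurable, as they involve only Z and Y, and each of them is
    null because P(|Z n - Y| > 1/(k+1)) tends to 0. *)
Lemma cvg_in_probability_pointwise_ae_eq (Z : nat -> {RV P >-> R})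
    (Y : {RV P >-> R}) (Y' : T -> R) :
  cvg_in_probability \oo Z Y -> (forall w, Z n w @[n --> \oo] --> Y' w) ->
  {ae P, forall w, Y' w = Y w}.
Proof.
move=> ZY ZY'.
pose A k n := [set w | k.+1%:R^-1 < `|Z n w - Y w|].
have mA k n : measurable (A k n).
  have -> : A k n = (fun w => `|Z n w - Y w|) @^-1` `]k.+1%:R^-1, +oo[.
    by apply/seteqP; split=> w; rewrite /A /= in_itv /= andbT.
  rewrite -[_ @^-1` _]setTI; apply: measurableT_comp => //.
  exact: measurable_funB.
have A0 k : P.-negligible [set w | \forall n \near \oo, A k n w].
  by apply: negligible_eventually => //; apply: ZY; rewrite invr_gt0.
apply: negligibleS (negligible_bigcup A0) => w /= /eqP YY'.
have e0 : 0 < `|Y' w - Y w| by rewrite normr_gt0 subr_eq0.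
have [k _ kP] := near_infty_natSinv_lt (PosNum e0).
exists k => //=.
have ZYk : `|Z n w - Y w| @[n --> \oo] --> `|Y' w - Y w|.
  by apply: cvg_norm; apply: cvgB; [exact: ZY'|exact: cvg_cst].
by apply: (cvgr_gt _ ZYk); exact: (kP k (leqnn _)).
Qed.

(** Along a sequence increasing to t the process converges to its left limit on
    every path, and to X_t in probability. *)
Lemma left_limit_ae_eq X t : cadlag_process X ->
  left_continuous_in_probability X -> 0 <= t ->
  {ae P, forall w, left_limit (fun s => X s w) t = X t w}.
Proof.
move=> cX lX; rewrite le_eqVlt => /predU1P[<-|t0].
  by apply: aeW => w; rewrite /left_limit eqxx.
pose s n := t - n.+1%:R^-1.
have st : s @ \oo --> t^'-.
  move=> U [e /= e0 eU]; change (\forall n \near \oo, U (s n)).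
  near=> n; apply: eU.
    rewrite /ball /= subKr gtr0_norm ?invr_gt0//.
    by near: n; exact: (near_infty_natSinv_lt (PosNum e0)).
  by rewrite /s ltrBlDr ltrDl invr_gt0.
apply: (@cvg_in_probability_pointwise_ae_eq (X \o s)) => [e e0|w].
  exact: cvg_comp st (lX t t0 e e0).
rewrite /left_limit gt_eqF//.
have [_ /(_ t t0) cvgX] := cX w.
exact: (cvg_comp s (fun r => X r w) st cvgX).
Unshelve. all: by end_near. Qed.

End process.

Theorem lemma4p4 (R : realType) (d : measure_display) (T : measurableType d)
    (P : probability T R) (X : R -> {RV P >-> R})
    (X_cadlag : cadlag_process X)
    (X_left_continuous : left_continuous_in_probability X) :
  {ae P, forall w,
    [set (t, left_limit (fun s => X s w) t) | t in [set t : R | 0 <= t]]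
      `<=` MSupp X}.
Proof.
pose J (q : rat * rat) : set R := `]ratr q.1, ratr q.2[%classic.
pose S q : set R := [set t | 0 <= t /\ P.-negligible (X t @^-1` J q)].
have [D DP] := choice (fun q => countable_left_dense _ (S q)).
have avoid : {ae P, forall w, forall q, setT q -> forall t, D q t ->
    ~ J q (X t w) /\ left_limit (fun s => X s w) t = X t w}.
  apply: ae_forall_countable => // q _; have [cD DS _] := DP q.
  apply: ae_forall_countable => // t /DS[t0 Jt].
  have nJt : {ae P, forall w, ~ J q (X t w)}.
    by apply: negligibleS Jt => w /= /contrapT.
  have le := left_limit_ae_eq _ _ X_cadlag X_left_continuous t0.
  by apply: filterS2 nJt le => w.
apply: filterS avoid => w avoid _ [t /= t0 <-]; split=> //=.
apply: contrapT => /negligible_preimage_rat_itv[q [qx Jt]].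
have [_ DS Dt] := DP q.
have [/(avoid q I)[nJ e]|nDt] := pselect (D q t).
  by apply: nJ; rewrite /J /= in_itv /= -e.
(* If t = 0 were not in D, points of S would accumulate at 0 from the left,
   but S contains no negative time. *)
have tpos : 0 < t.
  rewrite lt_neqAle t0 andbT; apply/eqP => t00.
  have [s /DS[s0 _] /andP[_]] := Dt t (conj t0 Jt) nDt 1 ltr01.
  by rewrite -t00 ltNge s0.
have : \forall s \near t^'-, J q (X s w).
  have [_ /(_ t tpos) cvgX] := X_cadlag w.
  apply: (cvgX (J q)); apply: open_nbhs_nbhs; split; first exact: itv_open.
  by move: qx; rewrite /left_limit gt_eqF// /J /= in_itv.
case=> e /= e0 eJ.
have [s Ds /andP[tes st]] := Dt t (conj t0 Jt) nDt e e0.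
have [nJ _] := avoid q I s Ds; apply: nJ; apply: eJ => //.
by rewrite /ball /= gtr0_norm ?subr_gt0// ltrBlDr addrC -ltrBlDr.
Qed.
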